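(* Let $\mathbb{F}\in\{\mathbb{R},\mathbb{C}\}$, let $(X,\Sigma,P)$ be a probability space, and let $\mathcal{H}\subseteq\mathbb{F}^X$ be a separable reproducing kernel Hilbert space whose reproducing kernel $K\colon X\times X\to\mathbb{F}$ is measurable. Let $\lambda\in L^2(X;P_K)$ and $f\in\mathcal{H}$. For each $n\in\mathbb{N}$ and $\delta>0$ consider the set $$A_{n,\delta}:=\Bigl\{(x_1,\ldots,x_n)\in X^n \;\Big|\; \Bigl\|f-\frac1n\sum_{i=1}^n\lambda(x_i)K_{x_i}\Bigr\|_{\mathcal{H}}\ge\delta\Bigr\}.$$ Then, letting $P^n$ denote the product probability measure on $X^n$, $$P^n(A_{n,\delta})\le\frac{1}{\delta^2}\,\bigl\|f-L_{P,K}\lambda\bigr\|_{\mathcal{H}}^2+\frac{1}{n\delta^2}\Bigl(\|\lambda\|_{L^2(X;P_K)}^2-\|L_{P,K}\lambda\|_{\mathcal{H}}^2\Bigr).$$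
   Context: A Hilbert space $\mathcal{H}\subseteq\mathbb{F}^X$ of functions on $X$ is a reproducing kernel Hilbert space (RKHS) with reproducing kernel $K$ if, writing $K_p:=K(\cdot,p)$, one has $K_p\in\mathcal{H}$ and $f(p)=\langle f,K_p\rangle$ for all $p\in X$ and $f\in\mathcal{H}$. Measurability of $K$ is with respect to the product $\sigma$-algebra $\Sigma\otimes\Sigma$. $P_K$ is the measure on $(X,\Sigma)$ defined by $dP_K(x)=K(x,x)\,dP(x)$. The operator $L_{P,K}\colon L^2(X;P_K)\to\mathcal{H}$ is the bounded linear operator $$L_{P,K}\lambda:=\int_X\lambda(x)K_x\,dP(x),$$ where the integral is a Bochner integral in $\mathcal{H}$ (it exists for every $\lambda\in L^2(X;P_K)$). *)

(* Defs.v *)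
From HB Require Import structures.
From mathcomp Require Import all_boot all_order all_algebra.
From mathcomp Require Import complex.
From mathcomp Require Import all_classical all_reals all_analysis.
From mathcomp Require Import measurable_realfun.

Set Implicit Arguments.
Unset Strict Implicit.
Unset Printing Implicit Defensive.

Import Order.TTheory GRing.Theory Num.Theory.
Import numFieldNormedType.Exports.

Local Open Scope classical_set_scope.
Local Open Scope ring_scope.

Variant scalar_kind := RealScalars | ComplexScalars.

Definition scalars (R : realType) (k : scalar_kind) : numFieldType :=
  match k with
  | RealScalars => R
  | ComplexScalars => R[i]
  end.

Definition conjS (R : realType) (k : scalar_kind) :
    scalars R k -> scalars R k :=
  match k with
  | RealScalars => id
  | ComplexScalars => @conjc R
  end.

Definition reS (R : realType) (k : scalar_kind) : scalars R k -> R :=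
  match k with
  | RealScalars => id
  | ComplexScalars => @complex.Re R
  end.

Definition ofR (R : realType) (k : scalar_kind) : R -> scalars R k :=
  match k with
  | RealScalars => id
  | ComplexScalars => fun r : R => (r%:C)%C
  end.

(* The norm of a normed module over R[i] takes its values in R[i], where it is
   a nonnegative real; [normR] is the same number seen in R. *)
Definition normR (R : realType) (k : scalar_kind)
  (E : normedModType (scalars R k)) (v : E) : R := reS `|v|.

Definition separable (T : topologicalType) : Prop :=
  exists2 D : set T, countable D & dense D.

Definition borel_measurable d (T : measurableType d) (U : ptopologicalType)
    (f : T -> U) : Prop :=
  measurable_fun [set: T] (f : T -> g_sigma_algebraType (@open U)).

(* A Hilbert space of functions on X is given by a space whose elements name
   functions on X through an injective, pointwise linear evaluation. The inner
   product is linear on the left and conjugate-linear on the right. *)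
Record function_hilbert_space (R : realType) (k : scalar_kind) (X : Type) :=
  FunctionHilbertSpace {
  fhs_space :> completeNormedModType (scalars R k);
  fhs_dot : {dot fhs_space for @conjS R k};
  fhs_norm_dot : forall f : fhs_space, `|f| ^+ 2 = fhs_dot f f;
  fhs_eval : fhs_space -> X -> scalars R k;
  fhs_eval_linear : forall p, scalar (fhs_eval^~ p);
  fhs_eval_inj : injective fhs_eval
}.

Record rkhs (R : realType) (k : scalar_kind) (X : Type) := Rkhs {
  rkhs_space :> function_hilbert_space R k X;
  rkhs_kernel : X -> X -> scalars R k;
  rkhs_section : X -> rkhs_space;
  rkhs_sectionE : forall p q, fhs_eval (rkhs_section p) q = rkhs_kernel q p;
  rkhs_reproducing : forall p (f : rkhs_space),
    fhs_eval f p = fhs_dot rkhs_space f (rkhs_section p)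
}.

Definition kernel_measurable (R : realType) (k : scalar_kind) d
    (X : measurableType d) (H : rkhs R k X) : Prop :=
  borel_measurable (fun z : X * X => rkhs_kernel H z.1 z.2).

Lemma reS_ge0 (R : realType) (k : scalar_kind) (z : scalars R k) :
  0 <= z -> 0 <= reS z.
Proof. by case: k z => //= -[a b]; rewrite lecE /= => /andP[]. Qed.

Lemma ler_norm_reS (R : realType) (k : scalar_kind) (z : scalars R k) :
  `|reS z| <= reS `|z|.
Proof.
case: k z => //= -[a b] /=.
by rewrite -sqrtr_sqr ler_sqrt ?lerDl ?sqr_ge0// addr_ge0 ?sqr_ge0.
Qed.

Lemma reSB (R : realType) (k : scalar_kind) (y z : scalars R k) :
  reS (y - z) = reS y - reS z.
Proof. by case: k y z => //= -[a b] [c d]. Qed.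

Lemma reS_lt_ofR (R : realType) (k : scalar_kind) (z : scalars R k) (e : R) :
  z < ofR k e -> reS z < e.
Proof. by case: k z => //= -[a b]; rewrite ltcE /= => /andP[]. Qed.

Lemma ofR_gt0 (R : realType) (k : scalar_kind) (e : R) : 0 < e -> 0 < ofR k e.
Proof. by case: k => //= e0; rewrite ltcR. Qed.

Lemma continuous_reS (R : realType) (k : scalar_kind) :
  continuous (@reS R k).
Proof.
move=> z A /nbhs_ballP[e /= e0 eA].
apply/nbhs_ballP; exists (ofR k e); first exact: ofR_gt0.
move=> w /= zw; apply: eA; rewrite /ball /= -reSB.
apply: le_lt_trans (ler_norm_reS _) _.
exact: reS_lt_ofR.
Qed.

Lemma measurable_reS (R : realType) (k : scalar_kind) d (T : measurableType d)
    (f : T -> scalars R k) :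
  borel_measurable f -> measurable_fun [set: T] (fun x => reS (f x)).
Proof.
move=> mf; apply: (measurability _ (RGenOpens.measurableE R)).
move=> _ [_ [a [b ->]] <-].
have := mf measurableT (@reS R k @^-1` `]a, b[); rewrite !setTI; apply.
apply: sub_sigma_algebra; move/continuousP: (@continuous_reS R k); apply.
exact: interval_open.
Qed.

Definition density d (T : measurableType d) (R : realType)
    (mu : {measure set T -> \bar R}) (w : T -> \bar R)
    of (forall x, 0 <= w x)%E & measurable_fun [set: T] w : set T -> \bar R :=
  fun A => (\int[mu]_(x in A) w x)%E.

Section density_measure.
Context d (T : measurableType d) (R : realType).
Context (mu : {measure set T -> \bar R}) (w : T -> \bar R).
Context (w0 : forall x, (0 <= w x)%E) (mw : measurable_fun [set: T] w).

Let density0 : density mu w0 mw set0 = 0%E.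
Proof. exact: integral_set0. Qed.

Let density_ge0 A : (0 <= density mu w0 mw A)%E.
Proof. by apply: integral_ge0 => x _; exact: w0. Qed.

Let density_sigma_additive : semi_sigma_additive (density mu w0 mw).
Proof.
move=> F mF tF mUF; rewrite /density ge0_integral_bigcup//.
- by apply: is_cvg_ereal_nneg_natsum => n _; exact: integral_ge0.
- exact: measurable_funTS.
Qed.

HB.instance Definition _ := isMeasure.Build _ _ _ (density mu w0 mw)
  density0 density_ge0 density_sigma_additive.

End density_measure.

Section kernel_diagonal.
Context (R : realType) (k : scalar_kind) d (X : measurableType d).
Context (H : rkhs R k X).

Lemma kernel_diag_ge0 (x : X) : (0 <= (reS (rkhs_kernel H x x))%:E)%E.
Proof.
rewrite lee_fin reS_ge0// -rkhs_sectionE rkhs_reproducing -fhs_norm_dot.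
by rewrite exprn_ge0.
Qed.

Lemma measurable_kernel_diag : kernel_measurable H ->
  measurable_fun [set: X] (fun x => (reS (rkhs_kernel H x x))%:E).
Proof.
move=> mK; apply/measurable_EFinP; apply: measurable_reS => _ B mB.
have mdiag : measurable_fun [set: X] (fun x : X => (x, x)).
  exact: measurable_fun_pair.
rewrite setTI; have := mK measurableT B mB; rewrite setTI => mKB.
by have := mdiag measurableT _ mKB; rewrite setTI.
Qed.

End kernel_diagonal.

(* K x x is real and nonnegative, being the squared norm of the section at x;
   [reS] only serves to see it in R. *)
Definition kernel_measure (R : realType) (k : scalar_kind) d
    (X : measurableType d) (P : probability X R) (H : rkhs R k X)
    (mK : kernel_measurable H) : {measure set X -> \bar R} :=
  density P (kernel_diag_ge0 H) (measurable_kernel_diag mK).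

Definition L2norm (R : realType) (k : scalar_kind) d (T : measurableType d)
    (mu : {measure set T -> \bar R}) (g : T -> scalars R k) : \bar R :=
  ('N[mu]_2%:E[ (fun x => (reS `|g x|)%:E) ])%E.

(* Elements of L^2 are handled through representatives. *)
Definition in_L2 (R : realType) (k : scalar_kind) d (T : measurableType d)
    (mu : {measure set T -> \bar R}) (g : T -> scalars R k) : Prop :=
  borel_measurable g /\ (L2norm mu g < +oo)%E.

Section bochner.
Context (R : realType) (k : scalar_kind) d (T : measurableType d).
Context (P : probability T R) (E : normedModType (scalars R k)).

Definition simple_fun (s : T -> E) : Prop :=
  finite_set (range s) /\ forall v, measurable (s @^-1` [set v]).

Definition simple_integral (s : T -> E) : E :=
  \sum_(v \in range s) ofR k (fine (P (s @^-1` [set v]))) *: v.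

(* P is finite, so every simple function is integrable. The almost sure
   convergence makes g strongly measurable; without it the integral of the norm
   below could be one of a non-measurable function. *)
Definition is_bochner_integral (g : T -> E) (v : E) : Prop :=
  exists s : nat -> T -> E, [/\
    forall n, simple_fun (s n),
    {ae P, forall x, s n x @[n --> \oo] --> g x},
    (\int[P]_x (normR (g x - s n x))%:E)%E @[n --> \oo] --> 0%E &
    simple_integral (s n) @[n --> \oo] --> v].

(* 0 when g is not Bochner integrable. *)
Definition bochner_integral (g : T -> E) : E :=
  xget 0 [set v | is_bochner_integral g v].

End bochner.

Definition kernel_operator (R : realType) (k : scalar_kind) d
    (X : measurableType d) (P : probability X R) (H : rkhs R k X)
    (g : X -> scalars R k) : H :=
  bochner_integral P (fun x => g x *: rkhs_section H x).

Definition tuple_cons (T : Type) n (z : T * n.-tuple T) : n.+1.-tuple T :=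
  [the n.+1.-tuple T of z.1 :: z.2].

Lemma measurable_tuple_cons d (T : measurableType d) n :
  measurable_fun [set: T * n.-tuple T] (@tuple_cons T n).
Proof. exact: measurable_cons. Qed.

HB.instance Definition _ d (T : measurableType d) n :=
  isMeasurableFun.Build _ _ _ _ (@tuple_cons T n) (@measurable_tuple_cons d T n).

Fixpoint power_probability d (T : measurableType d) (R : realType)
    (P : probability T R) (n : nat) : probability (n.-tuple T) R :=
  match n with
  | 0 => \d_ ([tuple] : 0.-tuple T)
  | n'.+1 => distribution (P \x power_probability P n')%E (@tuple_cons T n')
  end.

(* Main.v *)
(* With Y = lambda(x) K_x and L = E[Y], the identity
     E_n |g - sum_i Y_i|^2 = |g - n L|^2 + n (E|Y|^2 - |L|^2)   for all g in H
   follows by induction on n: Tonelli peels off the first sample x, the other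
   n - 1 samples are handled by the induction hypothesis at g - Y(x), and the
   case n = 1 is an expansion of the square. Markov's inequality at g = n f
   concludes, since E|Y|^2 is the squared norm of lambda in L^2(P_K).

   Analytically, one has to know that Y is strongly measurable, so that L exists
   as a Bochner integral with <L, h> = E<Y, h>. The functions in H whose
   scalar multiples have measurable real parts form a closed subspace containing
   all the K_p, hence all of H; so each x |-> <Y(x), h> is measurable, and
   mapping Y(x) to its nearest point among the first n terms of a dense sequence
   yields the approximating simple functions. *)

Require Import Defs.
From HB Require Import structures.
From mathcomp Require Import all_boot all_order all_algebra.
From mathcomp Require Import complex finmap.
From mathcomp Require Import all_classical all_reals all_analysis.
From mathcomp Require Import measurable_realfun.
From mathcomp Require Import ring lra.

Set Implicit Arguments.
Unset Strict Implicit.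
Unset Printing Implicit Defensive.

Import Order.TTheory GRing.Theory Num.Theory.
Import numFieldNormedType.Exports.

Local Open Scope classical_set_scope.
Local Open Scope ring_scope.

(** * Real and imaginary parts of scalars, uniformly over both fields *)

Section scalar_lemmas.
Context (R : realType) (k : scalar_kind).
Implicit Types (z w : scalars R k) (r s : R).

Definition imS z : R :=
  match k return scalars R k -> R with
  | RealScalars => fun=> 0
  | ComplexScalars => @complex.Im R
  end z.

Lemma reSD z w : reS (z + w) = reS z + reS w.
Proof. by case: k z w => //= -[a b] [c e]. Qed.

Lemma reSN z : reS (- z) = - reS z.
Proof. by case: k z => //= -[a b]. Qed.

Lemma reS0 : reS (0 : scalars R k) = 0.
Proof. by case: k. Qed.

Lemma reSM z w : reS (z * w) = reS z * reS w - imS z * imS w.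
Proof.
by rewrite /imS; case: k z w => /= [z w|[a b] [c e]] //; rewrite mulr0 subr0.
Qed.

Lemma imSM z w : imS (z * w) = reS z * imS w + imS z * reS w.
Proof.
rewrite /imS; case: k z w => /= [z w|[a b] [c e]] //.
by rewrite mulr0 mul0r addr0.
Qed.

Lemma imSD z w : imS (z + w) = imS z + imS w.
Proof.
by rewrite /imS; case: k z w => /= [z w|[a b] [c e]] //; rewrite addr0.
Qed.

Lemma imS0 : imS 0 = 0.
Proof. by rewrite /imS; case: k. Qed.

Lemma reS_conj z : reS (conjS z) = reS z.
Proof. by case: k z => //= -[a b]. Qed.

Lemma imS_conj z : imS (conjS z) = - imS z.
Proof. by rewrite /imS; case: k z => /= [z|[a b]] //; rewrite oppr0. Qed.

Lemma reS_ofR r : reS (ofR k r) = r.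
Proof. by case: k. Qed.

Lemma imS_ofR r : imS (ofR k r) = 0.
Proof. by rewrite /imS; case: k. Qed.

Lemma reS_imS_eq z w : reS z = reS w -> imS z = imS w -> z = w.
Proof. by rewrite /imS; case: k z w => //= -[a b] [c e] /= -> ->. Qed.

Lemma ofRD r s : ofR k (r + s) = ofR k r + ofR k s.
Proof. by apply: reS_imS_eq; rewrite (reSD, imSD) ?reS_ofR ?imS_ofR ?addr0. Qed.

Lemma ofR_natr n : ofR k (n%:R : R) = n%:R.
Proof.
elim: n => [|n IHn]; first by case: k.
by rewrite -!natr1 ofRD IHn; case: k.
Qed.

Lemma ler_reS z w : z <= w -> reS z <= reS w.
Proof. by move=> zw; rewrite -subr_ge0 -reSB reS_ge0// subr_ge0. Qed.

Lemma ge0_ofR_reS z : 0 <= z -> ofR k (reS z) = z.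
Proof. by case: k z => //= -[a b]; rewrite lecE /= => /andP[/eqP ->]. Qed.

(** A positive element of [R[i]] has zero imaginary part; hence the radii of balls, which live in
    [scalars R k], may be taken real. *)
Lemma gt0_ofRP z : 0 < z -> exists2 r, 0 < r & z = ofR k r.
Proof.
move=> z0; exists (reS z); last by rewrite ge0_ofR_reS// ltW.
by case: k z z0 => //= -[a b]; rewrite ltcE /= => /andP[].
Qed.

Lemma ltr_ofR r s : (ofR k r < ofR k s) = (r < s).
Proof. by case: k => //=; rewrite ltcR. Qed.

Lemma reS_norm_sqr z : reS `|z| ^+ 2 = reS z ^+ 2 + imS z ^+ 2.
Proof.
rewrite /imS; case: k z => /= [z|[a b]] /=; last first.
  by rewrite sqr_sqrtr// addr_ge0 ?sqr_ge0.
by rewrite real_normK ?num_real// expr0n addr0.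
Qed.

Lemma reS_norm_ge0 z : 0 <= reS `|z|.
Proof. exact: reS_ge0. Qed.

End scalar_lemmas.

(** * The real-valued norm, and convergence tested with real radii *)

Section normR_lemmas.
Context (R : realType) (k : scalar_kind) (E : normedModType (scalars R k)).
Implicit Types (u v : E).

Lemma ofR_normR v : ofR k (normR v) = `|v|.
Proof. by rewrite ge0_ofR_reS. Qed.

Lemma normR_ge0 v : 0 <= normR v.
Proof. exact: reS_ge0. Qed.

Lemma normR0 : normR (0 : E) = 0.
Proof. by rewrite /normR normr0 reS0. Qed.

Lemma normR_eq0 v : normR v = 0 -> v = 0.
Proof.
move=> v0; apply/eqP; rewrite -normr_eq0 -ofR_normR v0 (ofR_natr R k 0).
exact: eqxx.
Qed.

Lemma normRN v : normR (- v) = normR v.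
Proof. by rewrite /normR normrN. Qed.

Lemma normRB u v : normR (u - v) = normR (v - u).
Proof. by rewrite -opprB normRN. Qed.

Lemma ler_normRD u v : normR (u + v) <= normR u + normR v.
Proof. by rewrite /normR -reSD ler_reS// ler_normD. Qed.

Lemma normRZ (c : scalars R k) v : normR (c *: v) = reS `|c| * normR v.
Proof.
rewrite /normR normrZ reSM -[X in imS X * _](@ge0_ofR_reS _ _ `|c|)//.
by rewrite imS_ofR mul0r subr0.
Qed.

Lemma cvg_normRP (F : set_system nat) {FF : Filter F} (u : nat -> E) l :
  u n @[n --> F] --> l <-> normR (u n - l) @[n --> F] --> 0.
Proof.
split=> [/cvgrPdist_lt ul|/cvgrPdist_lt ul]; apply/cvgrPdist_lt => e e0.
  near=> n; rewrite sub0r normrN ger0_norm ?normR_ge0// normRB.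
  by apply: reS_lt_ofR; near: n; apply: ul; exact: ofR_gt0.
have [r r0 ->] := gt0_ofRP e0; near=> n.
rewrite -ofR_normR ltr_ofR normRB; near: n.
apply: filterS (ul r r0) => n; rewrite sub0r normrN ger0_norm ?normR_ge0//.
Unshelve. all: by end_near. Qed.

Lemma ball_normRP u v (e : R) : ball u (ofR k e) v = (normR (u - v) < e).
Proof. by rewrite -ball_normE /= -ofR_normR ltr_ofR. Qed.

End normR_lemmas.

Lemma normR_cauchy_cvg (R : realType) (k : scalar_kind)
    (E : completeNormedModType (scalars R k)) (u : nat -> E) :
  (forall e : R, 0 < e ->
    exists N, forall m n, (N <= m)%N -> (N <= n)%N -> normR (u m - u n) < e) ->
  exists l : E, u n @[n --> \oo] --> l.
Proof.
move=> uC; suff uc : cauchy (u @ \oo) by have /cauchy_cvgP/cvg_ex := uc.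
apply: cauchy_exP => _ /gt0_ofRP[e e0 ->].
have [N NP] := uC e e0; exists (u N); exists N => // n /= Nn.
by rewrite ball_normRP; exact: NP.
Qed.

(** * Real inner product, Cauchy-Schwarz and orthogonal projection *)

Section hilbert_space.
Context (R : realType) (k : scalar_kind) (X : Type).
Context (H : function_hilbert_space R k X).
Implicit Types (f g h : H).

(* The underlying real inner product, in which both scalar fields are treated
   alike; continuity and orthogonality only ever need the real part. *)
Definition rdot f g : R := reS (fhs_dot H f g).

Lemma fhs_dotC f g : fhs_dot H f g = conjS (fhs_dot H g f).
Proof. by rewrite hermitian_subproof expr0 mul1r. Qed.

Lemma rdotC f g : rdot f g = rdot g f.
Proof. by rewrite /rdot fhs_dotC reS_conj. Qed.

Lemma rdotDl f g h : rdot (f + g) h = rdot f h + rdot g h.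
Proof. by rewrite /rdot linearDl reSD. Qed.

Lemma rdotDr f g h : rdot h (f + g) = rdot h f + rdot h g.
Proof. by rewrite rdotC rdotDl !(rdotC h). Qed.

Lemma rdotNl f h : rdot (- f) h = - rdot f h.
Proof. by rewrite /rdot linearNl reSN. Qed.

Lemma rdotNr f h : rdot h (- f) = - rdot h f.
Proof. by rewrite rdotC rdotNl rdotC. Qed.

Lemma rdotZl (c : scalars R k) f h : rdot (c *: f) h = reS (c * fhs_dot H f h).
Proof. by rewrite /rdot linearZl_LR. Qed.

Lemma rdotZrl (r : R) f h : rdot (ofR k r *: f) h = r * rdot f h.
Proof. by rewrite rdotZl reSM reS_ofR imS_ofR mul0r subr0. Qed.

Lemma rdotZrr (r : R) f h : rdot h (ofR k r *: f) = r * rdot h f.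
Proof. by rewrite rdotC rdotZrl rdotC. Qed.

Lemma rdot0l h : rdot 0 h = 0.
Proof. by rewrite -[0](subrr 0) rdotDl rdotNl subrr. Qed.

Lemma rdot_suml (I : Type) (r : seq I) (F : I -> H) h :
  rdot (\sum_(i <- r) F i) h = \sum_(i <- r) rdot (F i) h.
Proof.
by elim/big_rec2: _ => [|i y x _ <-]; [rewrite rdot0l|rewrite rdotDl].
Qed.

Lemma normR_sqr f : normR f ^+ 2 = rdot f f.
Proof.
rewrite /rdot -fhs_norm_dot -ofR_normR [in RHS]expr2 reSM !imS_ofR !reS_ofR.
by rewrite mulr0 subr0.
Qed.

Lemma normR_sqrB f g :
  normR (f - g) ^+ 2 = normR f ^+ 2 - 2 * rdot f g + normR g ^+ 2.
Proof.
rewrite !normR_sqr rdotDl !rdotDr !rdotNl !rdotNr opprK (rdotC g f); ring.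
Qed.

(** Cauchy-Schwarz: for [g] nonzero, expand the nonnegative squared norm of [f] minus its real
    projection onto [g], then multiply by [normR g ^+ 2]. *)
Lemma rdot_le f g : `|rdot f g| <= normR f * normR g.
Proof.
have [g0|g0] := eqVneq (normR g) 0.
  by rewrite (normR_eq0 g0) rdotC rdot0l normr0 normR0 mulr0.
rewrite -[leLHS]ger0_norm// -ler_sqr ?nnegrE ?mulr_ge0 ?normR_ge0//.
rewrite ger0_norm// real_normK ?num_real//.
have g2 : normR g ^+ 2 != 0 by rewrite expf_neq0.
have g2_gt0 : 0 < normR g ^+ 2 by rewrite lt0r g2 sqr_ge0.
have := sqr_ge0 (normR (f - ofR k (rdot f g / normR g ^+ 2) *: g)).
rewrite normR_sqrB rdotZrr (normR_sqr (_ *: g)) rdotZrl rdotZrr -normR_sqr.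
rewrite -(pmulr_lge0 _ g2_gt0).
set a := normR f; set b := normR g ^+ 2 in g2 g2_gt0 *; set c := rdot f g.
have -> : (a ^+ 2 - 2 * (c / b * c) + c / b * (c / b * b)) * b =
  a ^+ 2 * b - c ^+ 2 by field.
by rewrite subr_ge0 exprMn.
Qed.

Lemma cvg_rdot (u : nat -> H) f g : u n @[n --> \oo] --> f ->
  rdot (u n) g @[n --> \oo] --> rdot f g.
Proof.
move=> /cvg_normRP uf; apply/subr_cvg0; apply: norm_cvg0.
have ng : normR (u n - f) * normR g @[n --> \oo] --> 0.
  by rewrite -(mul0r (normR g)); apply: cvgMl.
have bnd n : 0 <= `|rdot (u n) g - rdot f g| <= normR (u n - f) * normR g.
  by rewrite normr_ge0/= -rdotNl -rdotDl rdot_le.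
exact: (@squeeze_cvgr nat \oo _ R _ _ _ (nearW _ bnd) 0 (cvg_cst 0) ng).
Qed.

(** A sequence in [M] minimizing the distance to [h] is Cauchy by the parallelogram law; perturbing
    it in the direction [g] shows that its limit is the projection. Orthogonality is meant for
    [rdot], so [M] is a real subspace. *)
Lemma orthogonal_projection (M : set H) :
  M 0 -> (forall f g, M f -> M g -> M (f + g)) ->
  (forall (r : R) f, M f -> M (ofR k r *: f)) ->
  (forall (u : nat -> H) f, (forall n, M (u n)) ->
    u n @[n --> \oo] --> f -> M f) ->
  forall h, exists2 m, M m & forall g, M g -> rdot (h - m) g = 0.
Proof.
move=> M0 MD MZ Mcl h.
pose S := [set normR (h - m) ^+ 2 | m in M].
have S0 : S !=set0 by exists (normR (h - 0) ^+ 2); exists 0.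
have lbS : lbound S 0 by move=> _ [m _ <-]; rewrite sqr_ge0.
have infS : has_inf S by split => //; exists 0.
have infle m : M m -> inf S <= normR (h - m) ^+ 2.
  by move=> Mm; apply: ge_inf; [case: infS|exists m].
have /choice[u uP] (n : nat) :
    exists m, M m /\ normR (h - m) ^+ 2 < inf S + n.+1%:R^-1.
  have [|_ [m Mm <-] lt] := @inf_adherent _ S n.+1%:R^-1 _ infS.
    by rewrite invr_gt0.
  by exists m.
have Mu n := (uP n).1.
have parallelogram i j :
    normR (u i - u j) ^+ 2 <= 2 * (i.+1%:R^-1 + j.+1%:R^-1).
  (* The midpoint lies in [M], so its squared distance to [h] is at least [inf S], whereas those of
     [u i] and [u j] barely exceed it. *)
  have Mm : M (ofR k 2^-1 *: (u i + u j)) by apply: MZ; apply: MD.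
  have := infle _ Mm; have := (uP i).2; have := (uP j).2.
  rewrite !normR_sqrB !(normR_sqr (_ *: _)) !rdotZrl !rdotZrr !rdotDl !rdotDr.
  rewrite -!normR_sqr (rdotC (u j) (u i)).
  move: (i.+1%:R^-1) (j.+1%:R^-1) (inf S) => x y s; lra.
have [m um] : exists m : H, u n @[n --> \oo] --> m.
  apply: normR_cauchy_cvg => e e0.
  (* Beyond this [N] both reciprocals are below [e ^+ 2 / 4], so the parallelogram bound is below
     [e ^+ 2]. *)
  pose N := Num.truncn (4 / e ^+ 2); exists N => i j Ni Nj.
  have e2 : 0 < e ^+ 2 by rewrite exprn_gt0.
  rewrite -ltr_sqr ?nnegrE ?normR_ge0 ?ltW//.
  apply: le_lt_trans (parallelogram i j) _.
  have NP n : (N <= n)%N -> n.+1%:R^-1 < e ^+ 2 / 4.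
    move=> Nn; rewrite -[ltRHS]invrK ltf_pV2 ?posrE ?invr_gt0 ?divr_gt0//.
    rewrite invf_div (lt_le_trans (truncnS_gt _))// ler_nat.
    exact: Nn.
  have := NP _ Ni; have := NP _ Nj.
  by move: (i.+1%:R^-1) (j.+1%:R^-1) => x y; lra.
exists m => [|g Mg]; first exact: Mcl um.
(* First variation: [u n + t g] is in [M], hence not closer to [h] than [inf S] allows, while [u n]
   is within [n.+1%:R^-1] of it; let [n] tend to infinity. *)
have key t : 0 <= t ^+ 2 * normR g ^+ 2 - 2 * (t * rdot (h - m) g).
  have cv : t ^+ 2 * normR g ^+ 2 - 2 * (t * (rdot h g - rdot (u n) g)) +
      n.+1%:R^-1 @[n --> \oo] -->
      t ^+ 2 * normR g ^+ 2 - 2 * (t * (rdot h g - rdot m g)) + 0.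
    apply: cvgD; last exact: cvg_harmonic.
    apply: cvgB; first exact: cvg_cst.
    apply: cvgMr; apply: cvgMr; apply: cvgB; first exact: cvg_cst.
    exact: cvg_rdot.
  rewrite rdotDl rdotNl -[leRHS]addr0.
  rewrite -(cvg_lim _ cv)//; apply: limr_ge.
    by apply/cvg_ex; eexists; exact: cv.
  near=> n; have := infle _ (MD _ _ (Mu n) (MZ t _ Mg)).
  have := (uP n).2.
  rewrite opprD addrA (normR_sqrB (h - u n)) rdotZrr rdotDl rdotNl.
  rewrite (normR_sqr (_ *: _)) rdotZrl rdotZrr -normR_sqr.
  by move: (n.+1%:R^-1) (inf S) (normR (h - u n) ^+ 2) => x s y; nra.
(* With [t = b / (a + 1)] the quadratic equals [- t ^+ 2 * (a + 2)], which forces [b = 0]. The added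
   1 avoids dividing by zero when [g = 0]. *)
have := key (rdot (h - m) g / (normR g ^+ 2 + 1)).
set b := rdot _ _; set a := normR g ^+ 2.
have a1 : 0 < a + 1 by rewrite ltr_wpDl// sqr_ge0.
have a1n : a + 1 != 0 by rewrite gt_eqF.
have -> : (b / (a + 1)) ^+ 2 * a - 2 * (b / (a + 1) * b) =
    - (b / (a + 1)) ^+ 2 * (a + 2) by field.
have a2 : 0 < a + 2 by rewrite ltr_wpDl// sqr_ge0.
rewrite mulNr oppr_ge0 pmulr_lle0// => b0.
have /eqP : (b / (a + 1)) ^+ 2 = 0 by apply/eqP; rewrite eq_le b0 sqr_ge0.
by rewrite sqrf_eq0 mulf_eq0 invr_eq0 (negbTE a1n) orbF => /eqP.
Unshelve. all: by end_near. Qed.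

End hilbert_space.

(* Reduces the measurability of all functions in a scalar-closed family to that
   of their real parts. *)
Lemma imSE (R : realType) (k : scalar_kind) :
  exists c : scalars R k, forall z, imS z = reS (c * z).
Proof.
rewrite /imS; case: k => /=; first by exists 0 => z; rewrite mul0r.
by exists (0 +i* (-1))%C => -[a b] /=; rewrite mul0r mulN1r sub0r opprK.
Qed.

(** * Measurability of scalar functions by coordinates *)

Section scalar_measurability.
Context (R : realType) (k : scalar_kind) d (T : measurableType d).
Implicit Types (f g : T -> scalars R k).

Definition scalar_measurable f :=
  measurable_fun [set: T] (fun x => reS (f x)) /\
  measurable_fun [set: T] (fun x => imS (f x)).

Lemma borel_scalar_measurable f : borel_measurable f -> scalar_measurable f.
Proof.
move=> mf; split; first exact: measurable_reS.
have [c cE] := imSE R k; under eq_fun do rewrite cE.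
have cont : continuous (fun z : scalars R k => reS (c * z)).
  move=> z; apply: (@continuous_comp _ _ _ ( *%R c)).
    exact: mulrl_continuous.
  exact: continuous_reS.
apply: (measurability _ (RGenOpens.measurableE R)).
move=> _ [_ [a [b ->]] <-].
have := mf measurableT ((fun z => reS (c * z)) @^-1` `]a, b[).
rewrite !setTI; apply; apply: sub_sigma_algebra.
by move/continuousP: cont; apply; exact: interval_open.
Qed.

Lemma scalar_measurableM f g : scalar_measurable f -> scalar_measurable g ->
  scalar_measurable (fun x => f x * g x).
Proof.
move=> [rf jf] [rg jg]; split.
  under eq_fun do rewrite reSM.
  by apply: measurable_funB; apply: measurable_funM.
under eq_fun do rewrite imSM.
by apply: measurable_funD; apply: measurable_funM.
Qed.

Lemma scalar_measurable_conj f : scalar_measurable f ->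
  scalar_measurable (fun x => conjS (f x)).
Proof.
move=> [rf jf]; split; first by under eq_fun do rewrite reS_conj.
by under eq_fun do rewrite imS_conj; exact: measurableT_comp.
Qed.

End scalar_measurability.

(** * Measurability of the functions in the RKHS and of the pairings of kernel sections *)

Section rkhs_measurability.
Context (R : realType) (k : scalar_kind) d (X : measurableType d).
Context (H : rkhs R k X) (mK : kernel_measurable H).
Implicit Types (f g h : H).

Lemma kernel_scalar_measurable d' (T : measurableType d') (a b : T -> X) :
  measurable_fun [set: T] a -> measurable_fun [set: T] b ->
  scalar_measurable (fun x => rkhs_kernel H (a x) (b x)).
Proof.
move=> ma mb.
have [mr mi] := borel_scalar_measurable mK.
have mab : measurable_fun [set: T] (fun x => (a x, b x)).
  exact: measurable_fun_pair.
by split; [exact: (measurableT_comp mr mab)|exact: (measurableT_comp mi mab)].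
Qed.

Lemma fhs_evalZ (c : scalars R k) f p : fhs_eval (c *: f) p = c * fhs_eval f p.
Proof.
have e0 : fhs_eval (0 : H) p = 0.
  have := fhs_eval_linear p 1 (0 : H) 0; rewrite scale1r addr0 mul1r.
  by move=> /esym e00; apply: (addrI (fhs_eval (0 : H) p)); rewrite addr0.
by have := fhs_eval_linear p c f 0; rewrite addr0 => ->; rewrite e0 addr0.
Qed.

Lemma reS_eval f p : reS (fhs_eval f p) = rdot f (rkhs_section H p).
Proof. by rewrite rkhs_reproducing. Qed.

(** The set [M] is a real subspace, closed because norm convergence in [H] implies pointwise
    convergence. It contains all multiples of kernel sections, so [h] minus its projection [m] onto
    [M] vanishes at every point. *)
Lemma measurable_reS_eval h :
  measurable_fun [set: X] (fun x => reS (fhs_eval h x)).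
Proof.
pose M : set H := [set h | forall c : scalars R k,
  measurable_fun [set: X] (fun x => reS (fhs_eval (c *: h) x))].
have [|||| m Mm hm] := @orthogonal_projection _ _ _ H M _ _ _ _ h.
- move=> c; under eq_fun do rewrite scaler0 reS_eval rdot0l.
  exact: measurable_cst.
- move=> f g Mf Mg c.
  under eq_fun do rewrite scalerDr reS_eval rdotDl -!reS_eval.
  by apply: measurable_funD; [exact: Mf|exact: Mg].
- by move=> r f Mf c; under eq_fun do rewrite scalerA; exact: Mf.
- move=> u f Mu uf c.
  apply: (@measurable_fun_cvg _ _ _ _ (fun n x => reS (fhs_eval (c *: u n) x))).
    by move=> n; exact: Mu.
  move=> x _; rewrite reS_eval; under eq_fun do rewrite reS_eval.
  by apply: cvg_rdot; exact: cvgZl_tmp.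
suff -> : h = m by have := Mm 1; rewrite scale1r.
apply/eqP; rewrite -subr_eq0; apply/eqP.
apply: (@fhs_eval_inj _ _ _ H); apply/funext => p.
(* This multiple of the section is chosen so that its [rdot] with [h - m] is the squared modulus of
   [h - m] at [p]. *)
have section_M : M (fhs_eval (h - m) p *: rkhs_section H p).
  move=> c; under eq_fun do rewrite scalerA fhs_evalZ rkhs_sectionE.
  set a := c * _.
  have [mr mi] := kernel_scalar_measurable (@measurable_id _ X setT)
     (measurable_cst p : measurable_fun [set: X] _).
  under eq_fun do rewrite reSM.
  by apply: measurable_funB; apply: measurable_funM.
have := hm _ section_M.
rewrite rdotC rdotZl fhs_dotC -rkhs_reproducing reSM reS_conj imS_conj.
rewrite mulrN opprK => /eqP.
rewrite -!expr2 paddr_eq0 ?sqr_ge0// !sqrf_eq0 => /andP[/eqP r0 /eqP i0].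
rewrite -(scale0r (0 : H)) fhs_evalZ mul0r.
by apply: reS_imS_eq; rewrite ?r0 ?i0 ?reS0 ?imS0.
Qed.

Lemma scalar_measurable_eval h : scalar_measurable (fhs_eval h).
Proof.
split; first exact: measurable_reS_eval.
have [c cE] := imSE R k; under eq_fun do rewrite cE -fhs_evalZ.
exact: measurable_reS_eval.
Qed.

Context (lambda : X -> scalars R k) (ml : borel_measurable lambda).

Lemma measurable_rdot_section h :
  measurable_fun [set: X] (fun x => rdot (lambda x *: rkhs_section H x) h).
Proof.
under eq_fun do rewrite rdotZl fhs_dotC -rkhs_reproducing.
apply: (proj1 (scalar_measurableM _ _)); first exact: borel_scalar_measurable.
exact/scalar_measurable_conj/scalar_measurable_eval.
Qed.

(** The pairing is an explicit expression in [lambda] and the jointly measurable kernel. It serves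
    for squared norms of sums of samples and, on the diagonal, of a single one. *)
Lemma measurable_rdot_sections : measurable_fun [set: X * X] (fun z =>
  rdot (lambda z.1 *: rkhs_section H z.1) (lambda z.2 *: rkhs_section H z.2)).
Proof.
have ml' (c : X * X -> X) : measurable_fun [set: X * X] c ->
    scalar_measurable (lambda \o c).
  have [mr mi] := borel_scalar_measurable ml.
  move=> mc; split; first exact: (measurableT_comp mr mc).
  exact: (measurableT_comp mi mc).
have E x y :
    rdot (lambda x *: rkhs_section H x) (lambda y *: rkhs_section H y) =
    reS (lambda x * conjS (lambda y * rkhs_kernel H x y)).
  by rewrite rdotZl fhs_dotC -rkhs_reproducing fhs_evalZ rkhs_sectionE.
under eq_fun do rewrite E.
apply: (proj1 (scalar_measurableM _ _)); first exact: ml'.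
apply: scalar_measurable_conj; apply: scalar_measurableM; first exact: ml'.
exact: kernel_scalar_measurable.
Qed.

Lemma normR_section_sqr x :
  normR (lambda x *: rkhs_section H x) ^+ 2 =
  reS `|lambda x| ^+ 2 * reS (rkhs_kernel H x x).
Proof.
by rewrite normRZ exprMn normR_sqr -rkhs_sectionE reS_eval.
Qed.

End rkhs_measurability.

(** * Simple functions with values in a normed space *)

Section simple_functions.
Context (R : realType) (k : scalar_kind) d (T : measurableType d).
Context (P : probability T R) (E : normedModType (scalars R k)).
Context (s : T -> E) (ss : simple_fun s).

Lemma simple_fun_sum (G : E -> R) x : G (s x) =
  \sum_(v <- fset_set (range s)) G v * \1_(s @^-1` [set v]) x.
Proof.
rewrite (bigD1_seq (s x)) /= ?fset_uniq//; last first.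
  by rewrite in_fset_set ?inE; [exists x|exact: ss.1].
rewrite indicE mem_set// mulr1 big1 ?addr0// => v vs.
by rewrite indicE memNset ?mulr0// => /= sx; rewrite sx eqxx in vs.
Qed.

Let integrable_term (G : E -> R) v :
  P.-integrable setT (fun x => (G v * \1_(s @^-1` [set v]) x)%:E).
Proof.
under eq_fun do rewrite EFinM.
by apply: integrableZl => //; apply: integrable_indic; exact: ss.2.
Qed.

Lemma simple_fun_integrable (G : E -> R) :
  P.-integrable setT (fun x => (G (s x))%:E).
Proof.
under eq_fun do rewrite simple_fun_sum -sumEFin.
by apply: integrable_sum => // v _; exact: integrable_term.
Qed.

Lemma simple_fun_Rintegral (G : E -> R) : \int[P]_x G (s x) =
  \sum_(v <- fset_set (range s)) fine (P (s @^-1` [set v])) * G v.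
Proof.
rewrite /Rintegral; under eq_integral do rewrite simple_fun_sum -sumEFin.
rewrite (integral_sum measurableT (integrable_term G)).
rewrite (eq_bigr (fun v => (fine (P (s @^-1` [set v])) * G v)%:E)) ?sumEFin//.
move=> v _; under eq_integral do rewrite EFinM.
have mv := ss.2 v.
rewrite integralZl//; last exact: integrable_indic.
by rewrite integral_indic// setIT mulrC EFinM fineK ?fin_num_measure// muleC.
Qed.

(** The preimage splits over the finitely many values of [s]. This yields the measurability of the
    distance from [Y x] to [s x] from that of the distances to fixed points. *)
Lemma measurable_simple_comp (F : T -> E -> R) :
  (forall v, measurable_fun [set: T] (F^~ v)) ->
  measurable_fun [set: T] (fun x => F x (s x)).
Proof.
move=> mF _ B mB; rewrite setTI.
have -> : (fun x => F x (s x)) @^-1` B =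
    \bigcup_(v in range s) (s @^-1` [set v] `&` F^~ v @^-1` B).
  apply/seteqP; split => [x /= Bx|x [v _ [/= <-]]//].
  by exists (s x).
apply: fin_bigcup_measurable => [|v _]; first exact: ss.1.
apply: measurableI; first exact: ss.2.
by rewrite -[X in measurable X]setTI; exact: mF.
Qed.

End simple_functions.

Lemma measurable_normR_sqr (R : realType) (k : scalar_kind)
    (E : normedModType (scalars R k)) d (T : measurableType d) (Y : T -> E) :
  measurable_fun [set: T] (fun x => normR (Y x) ^+ 2) ->
  measurable_fun [set: T] (fun x => normR (Y x)).
Proof.
move=> mY2.
under eq_fun do rewrite -[normR _]ger0_norm ?normR_ge0// -sqrtr_sqr.
have msqrt : measurable_fun [set: R] (@Num.sqrt R).
  by apply: continuous_measurable_fun; exact: sqrt_continuous.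
exact: (measurableT_comp msqrt).
Qed.

(** * Pairing integrals of simple functions with a fixed vector *)

Section bochner_integral_in_hilbert_space.
Context (R : realType) (k : scalar_kind) (X : Type).
Context (H : function_hilbert_space R k X).
Context d (T : measurableType d) (P : probability T R).

Lemma rdot_simple_integral (s : T -> H) h : simple_fun s ->
  rdot (simple_integral P s) h = \int[P]_x rdot (s x) h.
Proof.
move=> ss; rewrite (simple_fun_Rintegral P ss (fun v => rdot v h)).
rewrite /simple_integral fsbig_finite; last exact: ss.1.
by rewrite rdot_suml; apply: eq_bigr => v _; rewrite rdotZrl.
Qed.

Context (Y : T -> H).
Hypothesis mY : forall h, measurable_fun [set: T] (fun x => rdot (Y x) h).
Hypothesis mYn : measurable_fun [set: T] (fun x => normR (Y x)).
Hypothesis iY : P.-integrable [set: T] (fun x => (normR (Y x))%:E).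

Lemma integrable_rdot h : P.-integrable [set: T] (fun x => (rdot (Y x) h)%:E).
Proof.
apply: (@le_integrable _ _ _ _ _ measurableT _
    (fun x => ((normR h)%:E * (normR (Y x))%:E)%E)).
- exact/measurable_EFinP.
- move=> x _ /=; rewrite lee_fin (le_trans (rdot_le _ _))// mulrC.
  by rewrite ger0_norm// mulr_ge0 ?normR_ge0.
- exact: integrableZl.
Qed.

Lemma measurable_normR_sub h :
  measurable_fun [set: T] (fun x => normR (Y x - h)).
Proof.
apply: measurable_normR_sqr; under eq_fun do rewrite normR_sqrB.
apply: measurable_funD => //; apply: measurable_funB.
  exact: measurable_funX.
exact: measurable_funM.
Qed.

Context (s : T -> H) (ss : simple_fun s).

Lemma integrable_normR_sub_simple :
  P.-integrable [set: T] (fun x => (normR (Y x - s x))%:E).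
Proof.
apply: (@le_integrable _ _ _ _ _ measurableT _
    (fun x => ((normR (Y x))%:E + (normR (s x))%:E)%E)).
- apply/measurable_EFinP.
  apply: (measurable_simple_comp ss (F := fun x v => normR (Y x - v))).
  exact: measurable_normR_sub.
- move=> x _ /=; rewrite lee_fin !ger0_norm ?addr_ge0 ?normR_ge0//.
  by rewrite -(normRN (s x)) ler_normRD.
- apply: integrableD => //.
  exact: (simple_fun_integrable P ss (@normR _ _ H)).
Qed.

(** This bound serves twice: to identify the pairing of the Bochner integral with [h], and to show
    that the integrals of the approximants form a Cauchy sequence. *)
Lemma rdot_simple_integral_dist h :
  `|rdot (simple_integral P s) h - \int[P]_x rdot (Y x) h| <=
  normR h * \int[P]_x normR (Y x - s x).
Proof.
rewrite distrC rdot_simple_integral//.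
have is_ : P.-integrable [set: T] (EFin \o (fun x => rdot (s x) h)).
  exact: (simple_fun_integrable P ss (fun v => rdot v h)).
rewrite -RintegralB//; last exact: integrable_rdot.
have iB : P.-integrable [set: T]
    (EFin \o (fun x => rdot (Y x) h - rdot (s x) h)).
  by have := integrableB measurableT (integrable_rdot h) is_; apply.
apply: le_trans (le_normr_Rintegral measurableT iB) _.
rewrite -RintegralZl//; last exact: integrable_normR_sub_simple.
apply: le_Rintegral => //.
- by have := integrable_abse iB; apply.
- have := integrableZl measurableT (normR h) integrable_normR_sub_simple.
  by apply.
- by move=> x _; rewrite -rdotNl -rdotDl mulrC rdot_le.
Qed.

End bochner_integral_in_hilbert_space.

(** * Existence of the Bochner integral and its weak characterization *)

Section bochner_existence.
Context (R : realType) (k : scalar_kind) (X : Type).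
Context (H : function_hilbert_space R k X).
Context d (T : measurableType d) (P : probability T R).
Context (Y : T -> H).
Hypothesis mY : forall h, measurable_fun [set: T] (fun x => rdot (Y x) h).
Hypothesis mYn : measurable_fun [set: T] (fun x => normR (Y x)).
Hypothesis iY : P.-integrable [set: T] (fun x => (normR (Y x))%:E).

Let cvg_Rintegral (s : nat -> T -> H) :
  (\int[P]_x (normR (Y x - s n x))%:E)%E @[n --> \oo] --> 0%E ->
  \int[P]_x normR (Y x - s n x) @[n --> \oo] --> 0.
Proof. by move=> s0; exact: (fine_cvg s0). Qed.

Lemma is_bochner_integral_rdot v h : is_bochner_integral P Y v ->
  rdot v h = \int[P]_x rdot (Y x) h.
Proof.
move=> [s [ss _ /cvg_Rintegral s0 sv]].
have bnd n :
    0 <= `|rdot (simple_integral P (s n)) h - \int[P]_x rdot (Y x) h| <=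
    normR h * \int[P]_x normR (Y x - s n x).
  by rewrite normr_ge0/= rdot_simple_integral_dist.
have b0 : normR h * (\int[P]_x normR (Y x - s n x)) @[n --> \oo] --> 0.
  by rewrite -(mulr0 (normR h)); apply: cvgMr.
have lim : rdot (simple_integral P (s n)) h @[n --> \oo] -->
    \int[P]_x rdot (Y x) h.
  apply/subr_cvg0; apply: norm_cvg0.
  exact: (@squeeze_cvgr nat \oo _ R _ _ _ (nearW _ bnd) 0 (cvg_cst 0) b0).
rewrite -(cvg_lim (@Rhausdorff R) lim); apply/esym/cvg_lim => //.
exact: cvg_rdot.
Qed.

(** The sequence starts at 0 so that the nearest-point approximants of [Y] have error at most the
    norm of [Y]. *)
Lemma separable_dense_seq : separable H ->
  exists2 u : nat -> H, u 0 = 0 &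
    forall f (e : R), 0 < e -> exists i, normR (f - u i) < e.
Proof.
move=> [D /pcard_surjP[g gD] dD].
exists (fun n => if n is m.+1 then g m else 0) => // f e e0.
have [|v [/=]] := dD (ball f (ofR k e)) _ (ball_open _ _).
  by exists f; exact: ballxx (ofR_gt0 k e0).
rewrite ball_normRP => fv /gD[i _ gi]; exists i.+1; rewrite gi; exact: fv.
Qed.

(** Candidates enter one at a time, so each stage changes the previous one only on the measurable
    set where the new candidate is strictly closer. *)
Fixpoint nearest (u : nat -> H) n (x : T) : H :=
  if n is m.+1 then
    if normR (Y x - u n) < normR (Y x - nearest u m x) then u n
    else nearest u m x
  else u 0.

Lemma nearest_le u i n x : (i <= n)%N ->
  normR (Y x - nearest u n x) <= normR (Y x - u i).
Proof.
elim: n => [|n IHn]; first by rewrite leqn0 => /eqP ->.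
rewrite leq_eqVlt => /predU1P[->|]; rewrite [nearest u n.+1 x]/=.
  by case: ltP.
by rewrite ltnS => /IHn le_n; case: ltP => // /ltW/le_trans; exact.
Qed.

Lemma nearest_simple u n : simple_fun (nearest u n).
Proof.
(* Fibres of constant functions are of this kind: the condition does not depend on the point. *)
have mprop (Q : Prop) : measurable [set _ : T | Q].
  have [q|q] := pselect Q.
    by rewrite (_ : [set _ | _] = setT)//; apply/seteqP; split.
  by rewrite (_ : [set _ | _] = set0)//; apply/seteqP; split.
elim: n => [|n [fn mn]] /=.
  split=> [|v]; last exact: mprop.
  by apply: (sub_finite_set (B := [set u 0])) => // _ [x _ <-].
pose A := [set x | normR (Y x - u n.+1) < normR (Y x - nearest u n x)].
have mA : measurable A.
  have msub := measurable_simple_comp (conj fn mn)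
    (F := fun x v => normR (Y x - v)) (measurable_normR_sub mY mYn).
  have := measurable_fun_ltr (measurable_normR_sub mY mYn (u n.+1)) msub.
  by move=> /(_ measurableT [set true] I); rewrite setTI.
split=> [|v].
  apply: (@sub_finite_set _ _ ([set u n.+1] `|` range (nearest u n))).
    move=> _ [x _ <-]; case: ifP => _; first by left.
    by right; exists x.
  by rewrite finite_setU; split.
rewrite [X in measurable X](_ : _ = (A `&` [set x | u n.+1 = v]) `|`
    (~` A `&` nearest u n @^-1` [set v])).
  apply: measurableU; apply: measurableI => //.
  exact: measurableC.
apply/seteqP; split=> x /=; rewrite /A /=.
  by case: ifP => xA /= xv; [left|right; split => //; rewrite xA].
by move=> [[-> ]|[/negP/negbTE ->]].
Qed.

Lemma bochner_integrable : separable H -> exists v, is_bochner_integral P Y v.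
Proof.
move=> /separable_dense_seq[u u0 du].
pose s := nearest u.
have ss n : simple_fun (s n) by exact: nearest_simple.
have s_cvg x : normR (Y x - s n x) @[n --> \oo] --> 0.
  apply/cvgrPdist_lt => e e0; have [i ie] := du (Y x) _ e0.
  exists i => // n /= le_in; rewrite sub0r normrN ger0_norm ?normR_ge0//.
  exact: le_lt_trans (nearest_le _ _ le_in) ie.
have int0 : (\int[P]_x (normR (Y x - s n x))%:E)%E @[n --> \oo] --> 0%E.
  rewrite -(integral0 P setT).
  apply: (dominated_cvg measurableT (g := fun x => (normR (Y x))%:E)) => //.
  - move=> n; apply/measurable_EFinP.
    apply: (measurable_simple_comp (ss n) (F := fun x v => normR (Y x - v))).
    exact: measurable_normR_sub.
  - by move=> x _; apply: cvg_EFin => //; [exact: nearW|exact: s_cvg].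
  (* Domination: [u 0 = 0] is always among the candidates. *)
  - move=> n x _ /=; rewrite lee_fin ger0_norm ?normR_ge0//.
    by rewrite -[Y x in leRHS]subr0 -u0 nearest_le.
have e0 := cvg_Rintegral int0.
have [v sv] : exists v : H, simple_integral P (s n) @[n --> \oo] --> v.
  apply: normR_cauchy_cvg => e e_gt0.
  have /cvgrPdist_lt/(_ (e / 2)) := e0; rewrite divr_gt0// => /(_ isT)[N _ NP].
  (* The difference [w] of two integrals is tested against itself: both are within
     [normR w * (e / 2)] of the same pairing, so [normR w ^+ 2 < normR w * e]. *)
  exists N => i j Ni Nj; set w := _ - _.
  have eN n : (N <= n)%N -> \int[P]_x normR (Y x - s n x) < e / 2.
    by move=> /NP /=; rewrite sub0r normrN => /(le_lt_trans (ler_norm _)).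
  have [w0|w0] := eqVneq (normR w) 0; first by rewrite w0.
  have w_gt0 : 0 < normR w by rewrite lt0r w0 normR_ge0.
  have := rdot_simple_integral_dist mY mYn iY (ss i) w.
  have := rdot_simple_integral_dist mY mYn iY (ss j) w.
  have : normR w * normR w =
      rdot (simple_integral P (s i)) w - rdot (simple_integral P (s j)) w.
    by rewrite -rdotNl -rdotDl -normR_sqr.
  have := eN _ Ni; have := eN _ Nj.
  rewrite !ler_norml => a b c /andP[p q] /andP[p' q'].
  rewrite -(ltr_pM2l w_gt0); nra.
exists v, s; split => //.
apply/aeW => x; apply/cvg_normRP; under eq_fun do rewrite normRB.
exact: s_cvg.
Qed.

Lemma bochner_integral_rdot h : separable H ->
  rdot (bochner_integral P Y) h = \int[P]_x rdot (Y x) h.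
Proof.
move=> sepH; apply: is_bochner_integral_rdot.
exact: (xgetPex 0 (bochner_integrable sepH)).
Qed.

End bochner_existence.

(** * Integration against a measure with a density *)

Section integral_density.
Context d (T : measurableType d) (R : realType).
Context (mu : {measure set T -> \bar R}) (w : T -> \bar R).
Context (w0 : forall x, (0 <= w x)%E) (mw : measurable_fun [set: T] w).
Hypothesis w_fin : forall x, w x \is a fin_num.
Local Open Scope ereal_scope.
Import HBNNSimple.

Let integral_density_nnsfun (h : {nnsfun T >-> R}) :
  \int[density mu w0 mw]_x (h x)%:E = \int[mu]_x ((h x)%:E * w x).
Proof.
have mind r :
    measurable_fun [set: T] (fun x => (r * \1_(h @^-1` [set r]) x)%:E).
  by apply/measurable_EFinP; exact: measurable_funM.
rewrite integralT_nnsfun sintegralE.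
transitivity (\int[mu]_x (\sum_(r \in range h)
    (r * \1_(h @^-1` [set r]) x)%:E * w x)); last first.
  apply: eq_integral => x _.
  rewrite -ge0_mule_fsuml => [|r]; last exact: nnfun_muleindic_ge0.
  by rewrite fsumEFin// -(fimfunE _ x).
rewrite ge0_integral_fsum//; last 2 first.
  by move=> r; apply: emeasurable_funM => //; exact: mind.
  by move=> r x _; rewrite mule_ge0// nnfun_muleindic_ge0.
apply: eq_fsbigr => _ /[!inE] -[t _ <-].
under [RHS]eq_integral do rewrite EFinM -muleA.
rewrite ge0_integralZl ?lee_fin//; last first.
- by move=> x _; rewrite mule_ge0// lee_fin.
- by apply: emeasurable_funM => //; exact/measurable_EFinP.
congr (_ * _).
transitivity (\int[mu]_(x in h @^-1` [set h t]) w x); first by [].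
rewrite integral_mkcond.
apply: eq_integral => x _; rewrite epatch_indic muleC; congr (_ * _).
Qed.

(** Monotone convergence from nonnegative simple functions; finiteness of [w] lets the pointwise
    limit pass through the product. *)
Lemma ge0_integral_density (g : T -> \bar R) :
  measurable_fun [set: T] g -> (forall x, 0 <= g x) ->
  \int[density mu w0 mw]_x g x = \int[mu]_x (g x * w x).
Proof.
move=> mg g0; pose h := nnsfun_approx measurableT mg.
have hg x : (h n x)%:E @[n --> \oo] --> g x by exact: cvg_nnsfun_approx.
have nd_h x : {homo (fun n => h n x) : m n / (m <= n)%N >-> (m <= n)%R}.
  by move=> m n mn; exact/lefP/nd_nnsfun_approx.
transitivity (limn (fun n => \int[density mu w0 mw]_x (h n x)%:E)).
  rewrite -monotone_convergence//.
  - by apply: eq_integral => x _; exact/esym/cvg_lim.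
  - by move=> n; exact/measurable_EFinP.
  - by move=> n x _; rewrite lee_fin.
  - by move=> x _ m n mn; rewrite lee_fin nd_h.
under eq_fun do rewrite integral_density_nnsfun.
rewrite -monotone_convergence//.
- by apply: eq_integral => x _; apply/cvg_lim => //; exact: cvgeZr.
- by move=> n; apply: emeasurable_funM => //; exact/measurable_EFinP.
- by move=> n x _; rewrite mule_ge0// lee_fin.
- by move=> x _ m n mn; rewrite lee_wpmul2r// lee_fin nd_h.
Qed.

End integral_density.

(** * Second moment of a sum of independent samples *)

Section second_moment.
Context (R : realType) (k : scalar_kind) (X : Type).
Context (H : function_hilbert_space R k X).
Context d (T : measurableType d) (P : probability T R).
Context (Y : T -> H) (L : H).
Hypothesis mY : forall h, measurable_fun [set: T] (fun x => rdot (Y x) h).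
Hypothesis mYY :
  measurable_fun [set: T * T] (fun z => rdot (Y z.1) (Y z.2)).
Hypothesis iY : forall h, P.-integrable [set: T] (fun x => (rdot (Y x) h)%:E).
Hypothesis iY2 : P.-integrable [set: T] (fun x => (normR (Y x) ^+ 2)%:E).
Hypothesis Ldot : forall h, rdot L h = \int[P]_x rdot (Y x) h.

(** The variance of [Y]: by [Ldot], it is the mean of [normR (Y x - L) ^+ 2]. *)
Let V := \int[P]_x (normR (Y x) ^+ 2) - normR L ^+ 2.

Lemma second_moment1 h :
  P.-integrable [set: T] (fun x => (normR (h - Y x) ^+ 2)%:E) /\
  \int[P]_x (normR (h - Y x) ^+ 2) = normR (h - L) ^+ 2 + V.
Proof.
have E x : normR (h - Y x) ^+ 2 =
    normR h ^+ 2 - 2 * rdot (Y x) h + normR (Y x) ^+ 2.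
  by rewrite normR_sqrB rdotC.
have i1 : P.-integrable [set: T] (EFin \o (fun=> normR h ^+ 2)).
  exact: finite_measure_integrable_cst.
have i2 : P.-integrable [set: T] (EFin \o (fun x => 2 * rdot (Y x) h)).
  by have := integrableZl measurableT 2 (iY h); apply.
have i12 : P.-integrable [set: T]
    (EFin \o (fun x => normR h ^+ 2 - 2 * rdot (Y x) h)).
  by have := integrableB measurableT i1 i2; apply.
split.
  under eq_fun do rewrite E.
  by have := integrableD measurableT i12 iY2; apply.
under eq_Rintegral do rewrite E.
rewrite RintegralD// RintegralB// RintegralZl//; last exact: iY.
rewrite -Ldot Rintegral_cst//.
rewrite [X in fine X]probability_setT mulr1 /V normR_sqrB (rdotC L); ring.
Qed.

(** Expanding the square leaves only real pairings, whose measurability is given by [mY] and, for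
    the double sum, [mYY]. *)
Lemma measurable_normR_sum n h : measurable_fun [set: n.-tuple T]
  (fun x => normR (h - \sum_(i < n) Y (tnth x i)) ^+ 2).
Proof.
have E (x : n.-tuple T) : normR (h - \sum_(i < n) Y (tnth x i)) ^+ 2 =
    normR h ^+ 2 - 2 * (\sum_(i < n) rdot (Y (tnth x i)) h) +
    \sum_(i < n) \sum_(j < n) rdot (Y (tnth x j)) (Y (tnth x i)).
  rewrite normR_sqrB rdotC rdot_suml (normR_sqr (\sum_(_ < _) _)) rdot_suml.
  by congr (_ + _); apply: eq_bigr => i _; rewrite rdotC rdot_suml.
under eq_fun do rewrite E.
apply: measurable_funD; first apply: measurable_funB => //.
  apply: measurable_funM => //; apply: measurable_sum => i.
  exact: measurableT_comp (mY h) (measurable_tnth i).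
apply: measurable_sum => i.
apply: measurable_sum => j.
apply: (measurableT_comp mYY (g := fun x : n.-tuple T => (tnth x j, tnth x i))).
by apply: measurable_fun_pair; exact: measurable_tnth.
Qed.

Lemma second_moment n h :
  (\int[power_probability P n]_x
     (normR (h - \sum_(i < n) Y (tnth x i)) ^+ 2)%:E)%E =
  (normR (h - L *+ n) ^+ 2 + n%:R * V)%:E.
Proof.
elim: n h => [|n IHn] h.
  rewrite /= integral_dirac//; last first.
    by apply/measurable_EFinP; exact: measurable_normR_sum.
  by rewrite diracT mul1e big_ord0 mulr0n mul0r addr0.
pose F (x : n.+1.-tuple T) :=
  (normR (h - \sum_(i < n.+1) Y (tnth x i)) ^+ 2)%:E.
have mF : measurable_fun setT F.
  by apply/measurable_EFinP; exact: measurable_normR_sum.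
have F0 x : (0 <= F x)%E by rewrite lee_fin sqr_ge0.
rewrite [LHS](ge0_integral_distribution (@tuple_cons T n) mF F0).
have mFc := measurableT_comp mF (@measurable_tuple_cons d T n).
rewrite (fubini_tonelli1 _ mFc (fun z => F0 _)).
(* For a fixed first sample [x], the inner integral is the induction hypothesis at [h - Y x]. *)
transitivity (\int[P]_x (normR (h - L *+ n - Y x) ^+ 2 + n%:R * V)%:E)%E.
  apply: eq_integral => x _; rewrite -addrAC -IHn /fubini_F.
  apply: eq_integral => y _; rewrite /F /= big_ord_recl opprD addrA tnth0.
  have -> // : \sum_(i < n) Y (tnth (tuple_cons (x, y)) (lift ord0 i)) =
      \sum_(i < n) Y (tnth y i).
  by apply: eq_bigr => i _; rewrite tnthS.
(* Integrating over the first sample contributes the remaining [L] and the remaining [V]. *)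
have [i1 e1] := second_moment1 (h - L *+ n).
have i2 : P.-integrable [set: T] (EFin \o (fun=> n%:R * V)).
  exact: finite_measure_integrable_cst.
under eq_integral do rewrite EFinD.
rewrite integralD// integral_cst// [X in (_ * X)%E]probability_setT mule1.
rewrite -(fineK (integrable_fin_num measurableT i1)) -EFinD.
rewrite [fine _]e1; congr EFin.
have -> : h - L *+ n.+1 = h - L *+ n - L by rewrite mulrSr opprD addrA.
by rewrite -[n.+1%:R]natr1; ring.
Qed.

End second_moment.

Lemma normR_mulrn (R : realType) (k : scalar_kind)
    (E : normedModType (scalars R k)) (v : E) n :
  normR (v *+ n) = n%:R * normR v.
Proof.
rewrite /normR normrMn mulr_natl.
by elim: n => [|n IHn]; rewrite ?mulr0n ?reS0// !mulrS reSD IHn.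
Qed.

(** * The weighted kernel sections for [lambda] in L2 of the kernel measure *)

Section rkhs_L2.
Context (R : realType) (k : scalar_kind) d (X : measurableType d).
Context (P : probability X R) (H : rkhs R k X) (mK : kernel_measurable H).
Context (lambda : X -> scalars R k) (ml : in_L2 (kernel_measure P mK) lambda).

(** The squared norm of [lambda x *: rkhs_section H x] is the squared modulus of [lambda x] times
    the kernel diagonal, which is the density of the kernel measure. Finiteness of the L2 norm makes
    [fine] faithful. *)
Lemma integral_normR_section_sqr :
  (\int[P]_x (normR (lambda x *: rkhs_section H x) ^+ 2)%:E)%E =
  (fine (L2norm (kernel_measure P mK) lambda) ^+ 2)%:E.
Proof.
have [mb fin_norm] := ml.
have [mre mim] := borel_scalar_measurable mb.
have mn : measurable_fun [set: X] (fun x => (reS `|lambda x| ^+ 2)%:E).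
  apply/measurable_EFinP; under eq_fun do rewrite reS_norm_sqr.
  by apply: measurable_funD; exact: measurable_funX.
transitivity (\int[kernel_measure P mK]_x (reS `|lambda x| ^+ 2)%:E)%E.
  rewrite /kernel_measure ge0_integral_density//.
  - by apply: eq_integral => x _; rewrite normR_section_sqr EFinM.
  - by move=> x; rewrite lee_fin sqr_ge0.
have N0 : (0 <= L2norm (kernel_measure P mK) lambda)%E by exact: Lnorm_ge0.
have Nfin : L2norm (kernel_measure P mK) lambda \is a fin_num.
  by rewrite ge0_fin_numE.
rewrite -powR_mulrn ?fine_ge0// -poweR_EFin fineK//.
rewrite /L2norm poweR_Lnorm//; apply: eq_integral => x _.
by rewrite /= (ger0_norm (reS_norm_ge0 _)) -powR_mulrn ?reS_norm_ge0.
Qed.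

Let Y x := lambda x *: rkhs_section H x.

Let measurable_normR_section_sqr :
  measurable_fun [set: X] (fun x => normR (Y x) ^+ 2).
Proof.
under eq_fun do rewrite normR_sqr.
have mdiag : measurable_fun [set: X] (fun x : X => (x, x)).
  exact: measurable_fun_pair.
exact: (measurableT_comp (measurable_rdot_sections mK ml.1) mdiag).
Qed.

Lemma integrable_normR_section_sqr :
  P.-integrable [set: X] (fun x => (normR (Y x) ^+ 2)%:E).
Proof.
apply/integrableP; split.
  exact/measurable_EFinP/measurable_normR_section_sqr.
under eq_integral do rewrite abse_EFin ger0_norm ?sqr_ge0//.
by rewrite integral_normR_section_sqr ltry.
Qed.

Lemma measurable_normR_section :
  measurable_fun [set: X] (fun x => normR (Y x)).
Proof.
exact/measurable_normR_sqr/measurable_normR_section_sqr.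
Qed.

Lemma integrable_normR_section :
  P.-integrable [set: X] (fun x => (normR (Y x))%:E).
Proof.
(* Square integrability suffices on a probability space, as [t <= 1 + t ^+ 2]. *)
apply: (@le_integrable _ _ _ _ _ measurableT _
    (fun x => (1 + (normR (Y x) ^+ 2)%:E)%E)).
- exact/measurable_EFinP/measurable_normR_section.
- move=> x _ /=; rewrite lee_fin !ger0_norm ?addr_ge0 ?sqr_ge0 ?normR_ge0//.
  by have := sqr_ge0 (normR (Y x) - 1); have := normR_ge0 (Y x); nra.
- apply: integrableD => //; last exact: integrable_normR_section_sqr.
  exact: finite_measure_integrable_cst.
Qed.

Lemma kernel_operator_rdot h : separable H ->
  rdot (kernel_operator P H lambda) h = \int[P]_x rdot (Y x) h.
Proof.
apply: bochner_integral_rdot.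
- exact: (measurable_rdot_section mK ml.1).
- exact: measurable_normR_section.
- exact: integrable_normR_section.
Qed.

End rkhs_L2.

(** * From sums to sample means, and Markov's inequality *)

Lemma normR_sample_mean (R : realType) (k : scalar_kind)
    (E : normedModType (scalars R k)) (f S : E) n : (0 < n)%N ->
  normR (f *+ n - S) = n%:R * normR (f - n%:R^-1 *: S).
Proof.
move=> n_gt0; rewrite -normR_mulrn mulrnBl -(scaler_nat n (_ *: S)) scalerA.
by rewrite mulfV ?scale1r// pnatr_eq0 -lt0n.
Qed.

Theorem theorem3p5 (R : realType) (k : scalar_kind)
    (d : measure_display) (X : measurableType d) (P : probability X R)
    (H : rkhs R k X) (mK : kernel_measurable H) (sepH : separable H)
    (lambda : X -> scalars R k) (lambda_L2 : in_L2 (kernel_measure P mK) lambda)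
    (f : H) (n : nat) (n_gt0 : (0 < n)%N) (delta : R) (delta_gt0 : 0 < delta) :
  let A : set (n.-tuple X) :=
    [set x | delta <= normR (f - n%:R^-1 *:
      \sum_(i < n) lambda (tnth x i) *: rkhs_section H (tnth x i))] in
  let Llambda := kernel_operator P H lambda in
  (power_probability P n A <=
    (delta ^- 2 * normR (f - Llambda) ^+ 2 +
     (n%:R * delta ^+ 2)^-1 *
       (fine (L2norm (kernel_measure P mK) lambda) ^+ 2 -
        normR Llambda ^+ 2))%:E)%E.
Proof.
cbv zeta; set A := (X in power_probability P n X).
set Llambda := kernel_operator P H lambda.
pose Y x := lambda x *: rkhs_section H x.
have mb := lambda_L2.1.
have mY h : measurable_fun [set: X] (fun x => rdot (Y x) h).
  exact: measurable_rdot_section.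
have mYY : measurable_fun [set: X * X] (fun z => rdot (Y z.1) (Y z.2)).
  exact: measurable_rdot_sections.
(* Clearing the factor [n%:R^-1] gives the form of [second_moment] at [f *+ n]; the threshold
   [delta] becomes [(n%:R * delta) ^+ 2] for [G]. *)
pose G (x : n.-tuple X) := normR (f *+ n - \sum_(i < n) Y (tnth x i)) ^+ 2.
have mG : measurable_fun setT G by exact: measurable_normR_sum.
have GE x : G x =
    n%:R ^+ 2 * normR (f - n%:R^-1 *: \sum_(i < n) Y (tnth x i)) ^+ 2.
  by rewrite /G normR_sample_mean// exprMn.
have n0 : 0 < n%:R :> R by rewrite ltr0n.
have nd0 : 0 < (n%:R * delta) ^+ 2 by rewrite exprn_gt0// mulr_gt0.
have AE x : A x = ((n%:R * delta) ^+ 2 <= G x).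
  rewrite GE exprMn ler_pM2l ?exprn_gt0//.
  by rewrite ler_sqr ?nnegrE ?normR_ge0 ?(ltW delta_gt0).
have mA : measurable A.
  have -> : A = [set x | (n%:R * delta) ^+ 2 <= G x].
    by apply/seteqP; split=> x; rewrite AE.
  have := measurable_fun_ler (measurable_cst ((n%:R * delta) ^+ 2)) mG.
  by move=> /(_ measurableT [set true] I); rewrite setTI.
have EG := second_moment mY mYY
  (integrable_rdot mY (integrable_normR_section lambda_L2))
  (integrable_normR_section_sqr lambda_L2)
  (fun h => kernel_operator_rdot lambda_L2 h sepH) n (f *+ n).
rewrite -mulrnBl normR_mulrn /Rintegral in EG.
rewrite (integral_normR_section_sqr lambda_L2)/= in EG.
(* The bound is the integral of [G] divided by [(n%:R * delta) ^+ 2]. *)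
have -> : delta ^- 2 * normR (f - Llambda) ^+ 2 + (n%:R * delta ^+ 2)^-1 *
    (fine (L2norm (kernel_measure P mK) lambda) ^+ 2 - normR Llambda ^+ 2) =
    ((n%:R * delta) ^+ 2)^-1 * ((n%:R * normR (f - Llambda)) ^+ 2 + n%:R *
    (fine (L2norm (kernel_measure P mK) lambda) ^+ 2 - normR Llambda ^+ 2)).
  by field; rewrite !gt_eqF.
have G0 x : setT x -> (0 <= (G x)%:E)%E by rewrite lee_fin sqr_ge0.
have mGE : measurable_fun setT (fun x => (G x)%:E) by exact/measurable_EFinP.
rewrite EFinM -EG -(ge0_integralZl_EFin _ measurableT G0 mGE)//; last first.
  by rewrite invr_ge0 ltW.
rewrite -(setIT A) -integral_indic//.
(* Markov's inequality: the indicator of [A] is at most [G] divided by the threshold, pointwise. *)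
apply: ge0_le_integral => //.
- by apply/measurable_EFinP; exact: measurable_indic.
- by apply/measurable_EFinP; exact: measurable_funM.
move=> x _; rewrite -EFinM lee_fin indicE.
have [|_] := boolP (x \in A).
  by rewrite inE AE => AGx; rewrite mulrC ler_pdivlMr// mul1r.
by rewrite mulr_ge0 ?invr_ge0 ?sqr_ge0.
Qed.
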